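(* Let $G$ be a finitely generated group and let $f:T_0\to T_\infty$ be a (surjective) $G$-equivariant morphism between $\mathbb{R}$-trees with isometric $G$-action. For all $s,t\ge 0$, one has $\Psi(\Psi(f,t),s)=\Psi(f,s+t)$ and $\Phi(\Psi(f,t),s)\circ\Phi(f,t)=\Phi(f,s+t)$.
   Context: An $\mathbb{R}$-tree is a connected metric space whose distance satisfies the $0$-hyperbolicity inequality $d(x,y)+d(z,t)\le\max(d(x,z)+d(y,t),d(x,t)+d(y,z))$; $[a,b]$ is the segment between $a$ and $b$. A morphism $f:T\to T'$ between $\mathbb{R}$-trees is a map such that each segment of $T$ is a finite union of subsegments each mapped isometrically into $T'$; morphisms are assumed to be surjective. For a morphism $f:T_0\to T_\infty$ (with distances $d_0,d_\infty$) and $a,b\in T_0$ with $f(a)=f(b)$, set $\tau(a,b)=\max_{x\in[a,b]}d_\infty(f(x),f(a))$. For $t\in[0,\infty)$, write $a\sim_t b$ if $f(a)=f(b)$ and $\tau(a,b)\le t$; this is an equivalence relation. Let $T_t=T_t(f)=T_0/{\sim_t}$, let $\varphi_t=\Phi(f,t):T_0\to T_t$ be the quotient map and $\psi_t=\Psi(f,t):T_t\to T_\infty$ the map induced by $f$, so $f=\psi_t\circ\varphi_t$. A $t$-subdivision between $a,b\in T_0$ is a sequence $\sigma=(a=y_0,x_1,y_1,\dots,x_n,y_n,x_{n+1}=b)$ of points of $T_0$ with $y_i\sim_t x_{i+1}$ for $0\le i\le n$; its length is $|\sigma|=\sum_{i=1}^n d_0(x_i,y_i)$. The metric on $T_t$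 is $d_t(\varphi_t(a),\varphi_t(b))=\inf_\sigma|\sigma|$ over all $t$-subdivisions between $a$ and $b$. With this metric $T_t$ is an $\mathbb{R}$-tree with an isometric $G$-action and $\varphi_t,\psi_t$ are equivariant morphisms, so that the construction can be applied to $\psi_t$. In the claim, the tree $T_s(\Psi(f,t))$ and the tree $T_{s+t}(f)$, both of which are quotients of $T_0$ as sets, are identified: the assertion is that they are the same quotient of $T_0$ with the same metric, and that the corresponding maps agree. *)

(* Defs.v *)
From HB Require Import structures.
From mathcomp Require Import all_boot all_order all_algebra.
From mathcomp Require Import all_classical all_reals all_analysis.

Set Implicit Arguments.
Unset Strict Implicit.
Unset Printing Implicit Defensive.

Import Order.TTheory GRing.Theory Num.Theory.
Local Open Scope classical_set_scope.
Local Open Scope ring_scope.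

(* Subgroups are boolean predicates; with classical logic these are all the
   subgroups of G. *)
Definition finitely_generated (G : groupType) : Prop :=
  exists S : seq G, forall H : {pred G},
    group_closed H -> {subset S <= H} -> forall g, g \in H.

Record isometric_action (R : realType) (G : groupType) (T : metricType R)
    (act : G -> T -> T) : Prop := IsometricAction {
  act_one : forall x, act 1%g x = x ;
  act_mul : forall g h x, act (g * h)%g x = act g (act h x) ;
  act_isom : forall g x y, mdist (act g x) (act g y) = mdist x y }.

Definition equivariant (G : Type) (T T' : Type) (act : G -> T -> T)
    (act' : G -> T' -> T') (f : T -> T') : Prop :=
  forall g x, f (act g x) = act' g (f x).

(* In an R-tree the unique arc from a to b is the metric interval. *)
Definition segment (R : realType) (T : Type) (d : T -> T -> R) (a b : T) :
    set T :=
  [set x | d a x + d x b = d a b].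

Record Rtree (R : realType) (T : metricType R) : Prop := IsRtree {
  Rtree_connected : connected [set: T] ;
  Rtree_0hyperbolic : forall x y z t : T,
    mdist x y + mdist z t <=
      Num.max (mdist x z + mdist y t) (mdist x t + mdist y z) }.

Record tree_morphism (R : realType) (T T' : metricType R) (f : T -> T') :
    Prop := IsTreeMorphism {
  tree_morphism_segment : forall a b : T, exists p : seq (T * T),
    segment mdist a b =
      \bigcup_(i < size p)
        segment mdist (nth (a, b) p i).1 (nth (a, b) p i).2 /\
    forall i, (i < size p)%N ->
      forall x y, segment mdist (nth (a, b) p i).1 (nth (a, b) p i).2 x ->
                  segment mdist (nth (a, b) p i).1 (nth (a, b) p i).2 y ->
                  mdist (f x) (f y) = mdist x y ;
  tree_morphism_surj : forall y : T', exists x : T, f x = y }.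

(* The construction of T_t(f), Phi(f,t) and Psi(f,t) uses only the distance
   functions of the source and of the target.  It is stated for arbitrary ones
   so that it can be applied both to f : T_0 -> T_oo and to
   Psi(f,t) : T_t(f) -> T_oo, without first proving that T_t(f) is an
   R-tree. *)
Section Folding.
Context {R : realType} {T T' : Type}.
Variables (d : T -> T -> R) (d' : T' -> T' -> R) (f : T -> T').

(* For a morphism of R-trees the set is nonempty, bounded and its supremum is
   attained, so that sup is the maximum. *)
Definition tau (a b : T) : R := sup [set d' (f x) (f a) | x in segment d a b].

Variable t : R.

Definition fold_equiv (a b : T) : Prop := f a = f b /\ tau a b <= t.

(* The quotient T_t(f), as the type of classes of fold_equiv. *)
Definition fold_tree : Type :=
  {C : set T | exists a, C = [set b | fold_equiv a b]}.

Definition Phi (a : T) : fold_tree :=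
  exist _ [set b | fold_equiv a b] (ex_intro _ a erefl).

Definition fold_repr (C : fold_tree) : T := projT1 (cid (proj2_sig C)).

Definition Psi (C : fold_tree) : T' := f (fold_repr C).

(* The list [:: (x_1, y_1); ...; (x_n, y_n)] encodes the sequence
   (a = y_0, x_1, y_1, ..., x_n, y_n, x_{n+1} = b). *)
Fixpoint subdivision (a b : T) (p : seq (T * T)) : Prop :=
  if p is (x, y) :: p' then fold_equiv a x /\ subdivision y b p'
  else fold_equiv a b.

Definition subdivision_length (p : seq (T * T)) : R :=
  \sum_(xy <- p) d xy.1 xy.2.

Definition fold_dist (C D : fold_tree) : R :=
  inf [set subdivision_length p | p in
         [set p | subdivision (fold_repr C) (fold_repr D) p]].

Definition fold_act (G : Type) (act : G -> T -> T) (g : G) (C : fold_tree) :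
    fold_tree :=
  Phi (act g (fold_repr C)).

End Folding.

Arguments Phi {R T T'} d d' f t a.
Arguments Psi {R T T'} d d' f t C.
Arguments fold_act {R T T'} d d' f t {G} act g C.
Arguments fold_dist {R T T'} d d' f t C D.

(* Main.v *)
(* Write D for the distance of T_t(f), pulled back to T_0.  The point is that a
   and b with f a = f b are identified in T_(s+t)(f) exactly when f stays within
   s of f a on the D-segment from a to b.

   D is 0-hyperbolic: take, by Zorn's lemma, a minimal 0-hyperbolic
   pseudo-distance delta between D and d_0.  Every pair a, b is joined by a
   delta-geodesic chain of f-isometric subsegments of [a, b].  If a ~_t b and
   delta a b > 0, the image of this chain leaves f a and comes back, hence it
   turns back somewhere, and folding delta at that turn contradicts minimality.
   So delta vanishes on ~_t, and delta = D.

   Hence a and b are joined by a D-geodesic chain, which is an optimal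
   t-subdivision.  If tau(a, b) <= s + t, a turn of this chain at a height
   greater than s above f a could be folded further by ~_t, against optimality;
   so the chain stays within s of f a, and by hyperbolicity so does the whole
   D-segment.  Conversely the jumps of the chain only leave its height by t. *)

Require Import Defs.
From HB Require Import structures.
From mathcomp Require Import all_boot all_order all_algebra.
From mathcomp Require Import all_classical all_reals all_analysis.
From mathcomp Require Import lra.

Set Implicit Arguments.
Unset Strict Implicit.
Unset Printing Implicit Defensive.

Import Order.TTheory GRing.Theory Num.Theory.
Local Open Scope ring_scope.

(** A pseudo-distance: distinct points may be at distance 0, so that the distances of all quotients
    of [T_0] can be compared on [T_0] itself. The triangle inequality and nonnegativity follow from
    the four-point inequality. *)
Record tree_dist (R : realType) (T : Type) (d : T -> T -> R) : Prop :=
    TreeDist {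
  tree_dxx : forall x, d x x = 0 ;
  tree_dC : forall x y, d x y = d y x ;
  tree_d4 : forall x y z w,
    d x y + d z w <= Num.max (d x z + d y w) (d x w + d y z) }.

(** * Segments of 0-hyperbolic pseudo-distances *)

Section TreeDist.
Context {R : realType} {T : Type}.
Variables (d : T -> T -> R) (td : tree_dist d).

Lemma tree_d4P x y z w :
  d x y + d z w <= d x z + d y w \/ d x y + d z w <= d x w + d y z.
Proof.
have := tree_d4 td x y z w; rewrite le_max.
by case/orP; [left|right].
Qed.

Lemma tree_tri y x z : d x z <= d x y + d y z.
Proof.
have yy := tree_dxx td y; have zy := tree_dC td z y.
by case: (tree_d4P x z y y) => ?; lra.
Qed.

Lemma tree_ge0 x y : 0 <= d x y.
Proof.
have xx := tree_dxx td x; have yy := tree_dxx td y.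
by case: (tree_d4P x x y y) => ?; lra.
Qed.

Lemma segment_refl a b : segment d a b a.
Proof. by rewrite /segment/= (tree_dxx td) add0r. Qed.

Lemma segment_reflr a b : segment d a b b.
Proof. by rewrite /segment/= (tree_dxx td) addr0. Qed.

Lemma segment_sym a b w : segment d a b w -> segment d b a w.
Proof.
rewrite /segment/= => h.
by rewrite (tree_dC td b) (tree_dC td w a) addrC h (tree_dC td).
Qed.

Lemma segmentW a b w : d a w + d w b <= d a b -> segment d a b w.
Proof. by move=> h; have := tree_tri w a b; rewrite /segment/=; lra. Qed.

Lemma segment_cover c a b w :
  segment d a b w -> segment d a c w \/ segment d c b w.
Proof.
rewrite {1}/segment/= => h.
have cw := tree_dC td c w; have ca := tree_dC td c a; have aw := tree_dC td a w.
case: (tree_d4P w c a b) => h4; [right|left]; apply: segmentW; lra.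
Qed.

Lemma segment_convex a b x y w :
  segment d a b x -> segment d a b y -> segment d x y w -> segment d a b w.
Proof.
rewrite {1 2 3}/segment/= => ax ay xy; apply: segmentW.
have xa := tree_dC td x a; have ya := tree_dC td y a.
have xw := tree_dC td x w; have yw := tree_dC td y w.
have h1 := tree_tri x a w; have h2 := tree_tri y w b.
have h3 := tree_tri y a w; have h4 := tree_tri x w b.
by case: (tree_d4P x y a b) => ?; lra.
Qed.

Lemma segment_trans a b u v :
  segment d a b u -> segment d u b v -> segment d a v u /\ segment d a b v.
Proof.
rewrite /segment/= => h1 h2; have h3 := tree_tri u a v.
by have h4 := tree_tri v a b; split; lra.
Qed.

Lemma segment_eq0 a b w w' : segment d a b w -> segment d a b w' ->
  d a w = d a w' -> d w w' = 0.
Proof.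
rewrite /segment/= => h1 h2 h3; have ge := tree_ge0 w w'.
have wa := tree_dC td w a; have wa' := tree_dC td w' a.
by case: (tree_d4P w w' a b) => ?; lra.
Qed.

End TreeDist.

(** * Geodesics in R-trees, from connectedness *)

Lemma mdist_tree (R : realType) (T : metricType R) :
  Rtree T -> tree_dist (@mdist R T).
Proof.
by move=> treeT; split;
  [exact: mdistxx|exact: metric_sym|exact: Rtree_0hyperbolic].
Qed.

(** If [[a, b]] had no point at distance [r < mdist a b] from [a], the points projecting to [[a, b]]
    within [r] of [a] would form a clopen set containing [a] but not [b]. *)
Lemma Rtree_geodesic (R : realType) (T : metricType R) (a b : T) (r : R) :
  Rtree T -> 0 <= r <= mdist a b ->
  exists2 w, mdist a w = r & mdist w b = mdist a b - r.
Proof.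
move=> treeT /andP[r0]; have td := mdist_tree treeT.
rewrite le_eqVlt => /orP[/eqP->|rab].
  by exists b; rewrite // mdistxx subrr.
apply: contrapT => nw.
pose g (w : T) := mdist a w + mdist a b - mdist w b.
(* [g w] is twice the Gromov product of [w] and [b] at [a], that is, twice the distance from [a] to
   the projection of [w] on [[a, b]]. *)
pose U := [set w : T | g w <= 2 * r]%classic.
have lipg w w' : g w' <= g w + 2 * mdist w w'.
  have h1 := tree_tri td w a w'; have h2 := tree_tri td w' w b.
  by rewrite /g; lra.
have oU : open U.
  rewrite openE => w Uw; apply/nbhs_ballP.
  have [gw|gw] := ltP (g w) (2 * r).
    exists (r - g w / 2) => /=; first lra.
    move=> w'; rewrite ballEmdist/= /U/= => ww'.
    by have := lipg w w'; lra.
  (* Here [g w = 2 * r], and [w] is off [[a, b]], or it would be the missing point. Half the excess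
     acts as the distance from [w] to [[a, b]]: nearer to [w] than that, the projection does not
     move. *)
  have Ew : 0 < mdist a w + mdist w b - mdist a b.
    rewrite lt_neqAle; apply/andP; split; last first.
      by have := tree_tri td w a b; lra.
    apply/eqP => e0; apply: nw; exists w; move: Uw gw; rewrite /U/= /g; lra.
  exists ((mdist a w + mdist w b - mdist a b) / 2) => /=; first lra.
  move=> w'; rewrite ballEmdist/= /U/= /g => ww'.
  have wb := tree_dC td w b; have wa := tree_dC td w a.
  have w'b := tree_dC td w' b; have w'a := tree_dC td w' a.
  have ba := tree_dC td b a; have tri := tree_tri td w' a b.
  move: Uw gw; rewrite /U/= /g.
  by case: (tree_d4P td w b a w') => ?; lra.
have cU : closed U.
  rewrite (_ : U = ~` [set w : T | 2 * r < g w])%classic; last first.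
    apply/seteqP; split=> w; rewrite /U/= leNgt; first by move/negP.
    by move=> h; apply/negP.
  apply: open_closedC; rewrite openE => w /= rw; apply/nbhs_ballP.
  exists (g w / 2 - r) => /=; first lra.
  move=> w'; rewrite ballEmdist/= => ww'.
  by have := lipg w' w; rewrite (tree_dC td w' w); lra.
have UT : U = [set: T]%classic.
  apply: (Rtree_connected treeT).
  - exists a; rewrite /U/= /g mdistxx; lra.
  - by exists U => //; rewrite setTI.
  - by exists U => //; rewrite setTI.
have : U b by rewrite UT.
by rewrite /U/= /g mdistxx; lra.
Qed.

(** * Following a morphism along a segment *)

Section Morphism.
Context {R : realType} {T T' : metricType R}.
Variables (f : T -> T') (treeT : Rtree T) (morf : tree_morphism f).

Let td := mdist_tree treeT.

Let covered (p : seq (T * T)) (w : T) : Prop :=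
  exists2 q, q \in p & segment mdist q.1 q.2 w.

Let uncovered_near (p : seq (T * T)) (v : T) : ~ covered p v ->
  exists2 e, 0 < e & forall w, mdist v w < e -> ~ covered p w.
Proof.
elim: p => [|[x y] p IH] nv.
  by exists 1 => // w _ [].
have [|e e0 He] := IH.
  by move=> [q qp qv]; apply: nv; exists q; rewrite // inE qp orbT.
have nxy : 0 < mdist x v + mdist v y - mdist x y.
  rewrite ltNge; apply/negP => h; apply: nv; exists (x, y).
    by rewrite inE eqxx.
  by apply: segmentW => //=; lra.
exists (Num.min e ((mdist x v + mdist v y - mdist x y) / 2)).
  by rewrite lt_min e0; lra.
move=> w; rewrite lt_min => /andP[we wxy] [q].
rewrite inE => /orP[/eqP->|qp]; last first.
  by move=> qw; apply: (He w) => //; exists q.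
rewrite /segment/= => h.
have h1 := tree_tri td w x v; have h2 := tree_tri td w v y.
by have h3 := tree_dC td v w; lra.
Qed.

(** The pieces of a subdivision come unordered and unoriented. The projection [v] of [b] on a piece
    is its exit point towards [b], wherever the piece was entered. *)
Let projection (c e b : T) : exists2 v, segment mdist c e v &
  forall u, segment mdist c e u -> segment mdist u b v.
Proof.
pose g := (mdist c e + mdist c b - mdist e b) / 2.
have h1 := tree_tri td e c b; have h2 := tree_tri td c e b.
have h3 := tree_tri td b c e.
have ec := tree_dC td e c; have be := tree_dC td b e; have bc := tree_dC td b c.
have [|v cv ve] := @Rtree_geodesic R T c e g treeT; first by rewrite /g; lra.
exists v; first by rewrite /segment/= cv ve; lra.
move=> u; rewrite {1}/segment/= => ceu; apply: segmentW => //.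
have vb : mdist v b <= (mdist c b + mdist e b - mdist c e) / 2.
  have vc := tree_dC td v c.
  by move: cv ve; rewrite /g; case: (tree_d4P td v b c e) => ? ? ?; lra.
have uc := tree_dC td u c; have vc := tree_dC td v c.
have h4 := tree_tri td u c b; have h5 := tree_tri td u e b.
have eu := tree_dC td e u.
by move: cv ve; rewrite /g; case: (tree_d4P td u v c e) => ? ? ?; lra.
Qed.

(* Walking along [a, b]: leave each piece of the subdivision at the point of
   that piece closest to b. *)
Lemma morphism_ind (P : T -> Prop) (a b : T) :
  P a ->
  (forall u v, segment mdist a b u -> segment mdist u b v ->
     mdist (f u) (f v) = mdist u v -> P u -> P v) ->
  P b.
Proof.
move=> Pa step; have [p [abp isop]] := tree_morphism_segment morf a b.
have {}isop q : q \in p -> forall x y, segment mdist q.1 q.2 x ->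
    segment mdist q.1 q.2 y -> mdist (f x) (f y) = mdist x y.
  move=> qp x y qx qy; apply: (isop (index q p)); rewrite ?index_mem //;
  by rewrite nth_index.
have cov w : segment mdist a b w -> covered p w.
  rewrite abp => -[i /= ip iw]; exists (nth (a, b) p i) => //.
  exact: mem_nth.
have main n : forall p u, (size p < n)%N -> segment mdist a b u -> P u ->
    (forall q, q \in p -> forall x y, segment mdist q.1 q.2 x ->
      segment mdist q.1 q.2 y -> mdist (f x) (f y) = mdist x y) ->
    (forall w, segment mdist u b w -> covered p w) -> P b; last first.
  exact: (main (size p).+1 p a _ (segment_refl td a b)).
elim: n => // n IH {abp cov isop}p u; rewrite ltnS => sp abu Pu isop cov.
have [[c e] qp qu] := cov _ (segment_refl td u b).
have [v cev vP] := projection c e b.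
have ubv := vP _ qu.
have Pv : P v.
  by apply: (step u v) => //; apply: (isop (c, e)).
have [<-//|/eqP nvb] := eqVneq v b.
have abv := (segment_trans td abu ubv).2.
(* Past [v] the piece [(c, e)] is never met again: a point [w] of it on [[v, b]] would have [v] on
   [[w, b]]. It can thus be dropped from the list. *)
have covW w : segment mdist v b w -> w != v -> covered (rem (c, e) p) w.
  move=> vbw nwv; have ubw := (segment_trans td ubv vbw).2.
  have [q qp' qw] := cov w ubw.
  have [qce|nq] := eqVneq q (c, e).
    move: qw; rewrite qce => /vP; move: vbw; rewrite /segment/=.
    have wv := tree_dC td w v; have := tree_ge0 td v w => ? ? ?.
    have /mdist_positivity wv0 : mdist w v = 0 by lra.
    by rewrite wv0 eqxx in nwv.
  by exists q => //; apply: rem_mem.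
apply: (IH (rem (c, e) p) v) => //.
- rewrite size_rem//; case: (p) qp sp => //.
- by move=> q /mem_rem; exact: isop.
(* The point [v] itself is still covered by the other pieces: their union is closed, and it contains
   points of [[v, b]] arbitrarily close to [v]. *)
- move=> w vbw; have [->|] := eqVneq w v; last exact: covW.
  apply: contrapT => /uncovered_near[eta eta0 etaP].
  have vb0 : 0 < mdist v b by rewrite mdist_gt0; apply/eqP.
  have [|w' vw' w'b] := 
      @Rtree_geodesic R T v b (Num.min (eta / 2) (mdist v b)) treeT.
    by rewrite ge_min lexx orbT andbT le_min; lra.
  have w'v : 0 < mdist v w' by rewrite vw' lt_min; lra.
  apply: (etaP w'); first by rewrite vw' gt_min; lra.
  apply: covW; first by rewrite /segment/= w'b; lra.
  by rewrite eq_sym -mdist_gt0.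
Qed.

Lemma morphism_lip (a b : T) : Rtree T' -> mdist (f a) (f b) <= mdist a b.
Proof.
move=> treeT'; pose P v := mdist (f a) (f v) <= mdist a v.
apply: (@morphism_ind P a b); first by rewrite /P !mdistxx.
move=> u v abu ubv fuv; rewrite /P => fau.
have := tree_tri (mdist_tree treeT') (f u) (f a) (f v).
by move: (segment_trans td abu ubv).1; rewrite /segment/=; lra.
Qed.

End Morphism.

(** * Chains of isometric edges and their turns *)

Section Chain.
Context {R : realType} {T T' : metricType R}.
Variables (f : T -> T') (treeT : Rtree T) (treeT' : Rtree T').
Variable morf : tree_morphism f.

Let td := mdist_tree treeT.
Let td' := mdist_tree treeT'.
Let lipf a b := morphism_lip treeT morf a b treeT'.

(** A 1-Lipschitz map that keeps the distance of the endpoints loses no length in between; hence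
    [edge] asks for isometry at the endpoints only. *)
Lemma isometric_subsegment x y z w : mdist (f x) (f y) = mdist x y ->
  segment mdist x y z -> segment mdist x y w -> mdist (f z) (f w) = mdist z w.
Proof.
rewrite /segment/= => fxy xz xw; apply/eqP; rewrite eq_le lipf /=.
have xz' := lipf x z; have xw' := lipf x w.
have zy' := lipf z y; have wy' := lipf w y.
have h1 := tree_tri td' (f z) (f x) (f y).
have h2 := tree_tri td' (f w) (f x) (f y).
have h3 := tree_tri td' (f w) (f z) (f y).
have h4 := tree_tri td' (f z) (f w) (f y).
have s1 := tree_dC td' (f z) (f w); have s2 := tree_dC td z x.
have s3 := tree_dC td w x.
by case: (tree_d4P td z w x y) => ?; lra.
Qed.

Section Edges.
Variables (delta : T -> T -> R) (a0 b0 : T).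

Definition edge (x y : T) : Prop :=
  [/\ segment mdist a0 b0 x, segment mdist a0 b0 y,
      0 < mdist x y & mdist (f x) (f y) = mdist x y].

(** The analogue of [subdivision] in which jumps have [delta]-length 0 and all pieces are isometric
    edges inside [[a0, b0]]. *)
Fixpoint chain (a b : T) (p : seq (T * T)) : Prop :=
  if p is (x, y) :: p' then [/\ delta a x = 0, edge x y & chain y b p']
  else delta a b = 0.

(** Height means distance to [f a0]. The strict inequalities say that, seen from [f y], the images
    of both edges start downwards, towards [f a0]; when [f y = f x'] they therefore overlap near
    [f y], although the path through [x], [y], [x'], [y'] is [delta]-geodesic. *)
Definition turn (s : R) (x y x' y' : T) : Prop :=
  [/\ edge x y, edge x' y', delta y x' = 0,
      mdist x y + mdist x' y' <= delta x y'
    & [/\ s < mdist (f a0) (f y),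
          mdist (f a0) (f x) < mdist (f a0) (f y) + mdist x y
        & mdist (f a0) (f y') < mdist (f a0) (f y) + mdist x' y']].

End Edges.

Local Notation len := (subdivision_length (@mdist R T)).

Lemma subdivision_length_cons x y (p : seq (T * T)) :
  len ((x, y) :: p) = mdist x y + len p.
Proof. by rewrite /subdivision_length big_cons. Qed.

Lemma subdivision_length_nil : len [::] = 0.
Proof. by rewrite /subdivision_length big_nil. Qed.

Lemma subdivision_length_cat (p q : seq (T * T)) :
  len (p ++ q) = len p + len q.
Proof. by rewrite /subdivision_length big_cat. Qed.

Variables (delta : T -> T -> R) (tdelta : tree_dist delta).
Hypothesis delta_le : forall x y, delta x y <= mdist x y.
Hypothesis delta_ge : forall x y, mdist (f x) (f y) <= delta x y.

Lemma delta0_f x y : delta x y = 0 -> f x = f y.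
Proof.
move=> h; apply: mdist_positivity.
by have := delta_ge x y; have := tree_ge0 td' (f x) (f y); lra.
Qed.

Lemma edge_delta a0 b0 x y : edge a0 b0 x y -> delta x y = mdist x y.
Proof.
by move=> [_ _ _ h]; have := delta_ge x y; have := delta_le x y; lra.
Qed.

Section Fixed.
Variables a0 b0 : T.
Local Notation edge := (edge a0 b0).
Local Notation chain := (chain delta a0 b0).

Lemma chain_start a' a b p : delta a a' = 0 -> chain a' b p -> chain a b p.
Proof.
have ge x y := tree_ge0 tdelta x y.
case: p => [|[x y] p] /= aa'.
  by have := tree_tri tdelta a' a b; have := ge a b; lra.
move=> [a'x e c]; split=> //.
by have := tree_tri tdelta a' a x; have := ge a x; lra.
Qed.

Lemma chain_cat m a b p1 p2 :
  chain a m p1 -> chain m b p2 -> chain a b (p1 ++ p2).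
Proof.
elim: p1 a => [|[x y] p1 IH] a /=; first exact: chain_start.
by move=> [ax e c] c2; split=> //; exact: IH.
Qed.

Lemma chain_le a b p : chain a b p -> delta a b <= len p.
Proof.
elim: p a => [|[x y] p IH] a /=.
  by move=> ->; rewrite subdivision_length_nil.
move=> [ax /edge_delta e /IH c]; rewrite subdivision_length_cons.
by have := tree_tri tdelta x a b; have := tree_tri tdelta y x b; lra.
Qed.

Lemma len_ge0 (p : seq (T * T)) : 0 <= len p.
Proof. by apply: sumr_ge0 => i _; exact: mdist_ge0. Qed.

Lemma edge_split x y r : edge x y -> 0 < r < mdist x y -> exists m,
  [/\ edge x m, edge m y, mdist x m = r & mdist m y = mdist x y - r].
Proof.
move=> [ax ay xy fxy] rxy.
have [|m xm my] := @Rtree_geodesic R T x y r treeT; first lra.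
have xym : segment mdist x y m by rewrite /segment/=; lra.
have am := segment_convex td ax ay xym.
exists m; split=> //; split=> //; try lra;
  apply: (isometric_subsegment fxy) => //.
- exact: segment_refl.
- exact: segment_reflr.
Qed.

Lemma chain_split a b p r : chain a b p -> 0 <= r <= len p ->
  exists m p1 p2, [/\ chain a m p1, chain m b p2,
    len p1 = r & len p2 = len p - r].
Proof.
elim: p a r => [|[x y] p IH] a r.
  rewrite subdivision_length_nil => c r0; exists a, [::], [::]; split => //=.
  - exact: tree_dxx.
  - by rewrite subdivision_length_nil; lra.
  - by rewrite subdivision_length_nil; lra.
move=> c; have [<-|r0] := eqVneq 0 r.
  move=> _; exists a, [::], ((x, y) :: p); split => //.
  - exact: tree_dxx.
  - exact: subdivision_length_nil.
  - by rewrite subr0.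
move: c => /= [ax e c]; rewrite subdivision_length_cons => rp.
have [rxy|xyr] := ltP r (mdist x y).
  have [|m [em1 em2 xm my]] := edge_split (r := r) e.
    by rewrite rxy lt_neqAle r0; lra.
  exists m, [:: (x, m)], ((m, y) :: p); split => //=.
  - by split=> //; exact: tree_dxx.
  - by split=> //; exact: tree_dxx.
  - by rewrite subdivision_length_cons subdivision_length_nil; lra.
  - by rewrite subdivision_length_cons; lra.
have [|m [p1 [p2 [c1 c2 l1 l2]]]] := IH y (r - mdist x y) c; first lra.
exists m, ((x, y) :: p1), p2; split => //=.
- by rewrite subdivision_length_cons; lra.
- by lra.
Qed.

(** If the next edge is not a turn, it climbs straight away from [f a0], and the hypotheses pass on
    to it. The chain ends at height at most [s], so the climb must stop. *)
Lemma turn_ascending s b p x y : edge x y -> chain y b p ->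
  mdist x y + len p <= delta x b ->
  s < mdist (f a0) (f y) -> mdist (f a0) (f b) <= s ->
  mdist (f a0) (f x) < mdist (f a0) (f y) + mdist x y ->
  exists x y x' y', turn delta a0 b0 s x y x' y'.
Proof.
move=> + + + + bs; elim: p x y => [|[x' y'] p IH] x y e /=.
  by move=> /delta0_f ->; lra.
move=> [yx' e' c]; rewrite subdivision_length_cons => opt ys xy.
have e0 : 0 < mdist x' y' by case: e'.
have fy := delta0_f yx'.
have [turn_here|up] := ltP (mdist (f a0) (f y'))
    (mdist (f a0) (f y) + mdist x' y').
  exists x, y, x', y'; split=> //.
  by have := tree_tri tdelta y' x b; have := chain_le c; lra.
apply: (IH x' y') => //; try lra; last by rewrite -fy; lra.
have := tree_tri tdelta x' x b; have := tree_tri tdelta y x x'.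
by have := edge_delta e; lra.
Qed.

(** The first edge whose far end is higher than [s] exists because of [m]; it starts at height at
    most [s], so [turn_ascending] applies from there. *)
Lemma turn_exists s a m b p1 p2 : chain a m p1 -> chain m b p2 ->
  len p1 + len p2 <= delta a b ->
  mdist (f a0) (f a) <= s -> s < mdist (f a0) (f m) ->
  mdist (f a0) (f b) <= s ->
  exists x y x' y', turn delta a0 b0 s x y x' y'.
Proof.
move=> + c2 + + ms bs; elim: p1 a => [|[x y] p1 IH] a /=.
  by move=> /delta0_f ->; lra.
move=> [ax e c1]; rewrite subdivision_length_cons => opt hs.
have e0 : 0 < mdist x y by case: e.
have fax := delta0_f ax; have exy := edge_delta e.
have [ys|sy] := leP (mdist (f a0) (f y)) s.
  apply: (IH y) => //.
  by have := tree_tri tdelta x a b; have := tree_tri tdelta y x b; lra.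
apply: (turn_ascending e (chain_cat c1 c2)) => //; last by rewrite -fax; lra.
rewrite subdivision_length_cat.
by have := tree_tri tdelta x a b; lra.
Qed.

End Fixed.

(* A chain from a to u followed by an edge [u, v] is made optimal by cutting
   off the common part of the tripod a, u, v of the tree dist delta. *)
Lemma chain_exists a b : exists2 p, chain delta a b a b p & len p = delta a b.
Proof.
apply: (@morphism_ind _ _ _ _ treeT morf
  (fun v => exists2 p, chain delta a b a v p & len p = delta a v)).
  exists [::]; first exact: tree_dxx.
  by rewrite subdivision_length_nil (tree_dxx tdelta).
move=> u v abu ubv fuv [p c lp].
have [<-|nuv] := eqVneq u v; first by exists p.
have uv0 : 0 < mdist u v by rewrite mdist_gt0.
have abv := (segment_trans td abu ubv).2.
have duv : delta u v = mdist u v.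
  by have := delta_ge u v; have := delta_le u v; lra.
(* The Gromov product of [a] and [v] at [u]: the length of the common part of [[u, a]] and
   [[u, v]]. *)
pose g := (delta a u + delta u v - delta a v) / 2.
have t1 := tree_tri tdelta u a v; have t2 := tree_tri tdelta v a u.
have t3 := tree_tri tdelta a u v.
have s1 := tree_dC tdelta v u; have s2 := tree_dC tdelta u a.
have [|m [p1 [p2 [c1 c2 l1 l2]]]] := chain_split (r := delta a u - g) c.
  by rewrite lp /g; lra.
have am := chain_le c1; have mu := chain_le c2.
(* Both [m], cut from the chain at [delta]-distance [g] before [u], and any such [m'] sit at the
   centre of the tripod. *)
have junction m' : delta u m' <= g -> delta m' v <= delta u v - g ->
    delta m m' = 0.
  move=> um' m'v; have ge := tree_ge0 tdelta m m'.
  have s3 := tree_dC tdelta m a; have s4 := tree_dC tdelta m' u.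
  have s5 := tree_dC tdelta m' a.
  have m'a : delta m' a <= delta a u - g.
    move: um' m'v; rewrite /g.
    by case: (tree_d4P tdelta m' a u v) => ? ? ?; lra.
  by case: (tree_d4P tdelta m m' u a) => ?; lra.
(* The new edge is absorbed entirely by the chain; it is treated apart because edges have positive
   length. *)
have [gd|gd] := eqVneq g (mdist u v).
  exists p1; last by move: gd; rewrite l1 /g; lra.
  rewrite -[p1]cats0; apply: (chain_cat c1) => /=; apply: junction.
  - by rewrite gd duv.
  - by rewrite gd duv subrr (tree_dxx tdelta).
have [|m' um' m'v] := @Rtree_geodesic R T u v g treeT.
  by rewrite -duv /g; lra.
have uvm' : segment mdist u v m' by rewrite /segment/=; lra.
have gle : g < mdist u v by rewrite lt_neqAle gd -duv /g; lra.
exists (p1 ++ [:: (m', v)]).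
  apply: (chain_cat c1); split; last exact: tree_dxx.
  - apply: junction; first by rewrite -um'.
    by rewrite duv -m'v.
  - split=> //; first exact: (segment_convex td abu abv uvm').
    + lra.
    + by apply: (isometric_subsegment fuv) => //; exact: segment_reflr.
rewrite subdivision_length_cat subdivision_length_cons subdivision_length_nil.
by rewrite l1 m'v -duv /g; lra.
Qed.

End Chain.

(** The set under [sup] is nonempty and bounded by [d a b], so the bound on [tau] can be read
    pointwise. Allowing a pseudo-distance on a bare type serves [f] and the induced map on [T_t]
    alike. *)
Lemma fold_equivP (R : realType) (T T' : Type) (d : T -> T -> R)
    (d' : T' -> T' -> R) (f : T -> T') (t : R) (a b : T) :
  tree_dist d -> (forall x y, d' x y = d' y x) ->
  (forall x y, d' (f x) (f y) <= d x y) ->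
  fold_equiv d d' f t a b <->
  f a = f b /\ forall w, segment d a b w -> d' (f a) (f w) <= t.
Proof.
move=> td dC' lipf.
have bounded w : segment d a b w -> d' (f w) (f a) <= d a b.
  rewrite /segment/= => h; rewrite dC'.
  by have := lipf a w; have := tree_ge0 td w b; lra.
split=> -[fab h]; split=> //.
  move=> w abw; apply: le_trans h; rewrite dC'.
  apply: ub_le_sup; last by exists w.
  by exists (d a b) => _ [x abx <-]; exact: bounded.
apply: ge_sup; first by exists (d' (f a) (f a)), a => //; exact: segment_refl.
by move=> _ [x abx <-]; rewrite dC'; exact: h.
Qed.

(** * The relation [sim t] and the distance of [T_t] pulled back to [T_0] *)

Section FoldMetric.
Context {R : realType} {T T' : metricType R}.
Variables (f : T -> T') (treeT : Rtree T) (treeT' : Rtree T').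
Variable morf : tree_morphism f.

Let td := mdist_tree treeT.
Let td' := mdist_tree treeT'.
Let lipf a b := morphism_lip treeT morf a b treeT'.

Local Notation len := (subdivision_length (@mdist R T)).
Local Notation sim := (fold_equiv (@mdist R T) (@mdist R T') f).
Local Notation subdiv := (subdivision (@mdist R T) (@mdist R T') f).

Lemma fold_equiv_mdistP t a b : sim t a b <-> f a = f b /\
  forall w, segment mdist a b w -> mdist (f a) (f w) <= t.
Proof. exact: (fold_equivP _ _ _ td (tree_dC td') lipf). Qed.

Lemma fold_equiv_sym t a b : sim t a b -> sim t b a.
Proof.
move=> /fold_equiv_mdistP[fab h]; apply/fold_equiv_mdistP.
split=> // w /(segment_sym td) /h.
by rewrite fab.
Qed.

Lemma fold_equiv_trans t a b c : sim t a b -> sim t b c -> sim t a c.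
Proof.
move=> /fold_equiv_mdistP[fab h] /fold_equiv_mdistP[fbc h'].
apply/fold_equiv_mdistP; split; first by rewrite fab.
move=> w /(segment_cover td b)[/h//|/h']; by rewrite fab.
Qed.

Lemma fold_equiv_le t t' a b : t <= t' -> sim t a b -> sim t' a b.
Proof.
move=> tt' /fold_equiv_mdistP[fab h]; apply/fold_equiv_mdistP; split=> // w /h.
by move=> /le_trans; exact.
Qed.

Definition fold_pdist (t : R) (a b : T) : R :=
  inf [set len p | p in [set p | subdiv t a b p]]%classic.

Variables (t : R) (t0 : 0 <= t).

Lemma fold_equiv_refl a : sim t a a.
Proof.
apply/fold_equiv_mdistP; split=> // w; rewrite /segment/= (tree_dxx td) => aw.
have := tree_dC td w a; have := tree_ge0 td a w => ? ?.
have := lipf a w; have := t0; lra.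
Qed.

Lemma subdivision_start a' a b p :
  sim t a a' -> subdiv t a' b p -> subdiv t a b p.
Proof.
case: p => [|[x y] p] /= aa'; first exact: fold_equiv_trans.
by move=> [a'x c]; split=> //; exact: fold_equiv_trans a'x.
Qed.

Lemma subdivision_cat m a b p q :
  subdiv t a m p -> subdiv t m b q -> subdiv t a b (p ++ q).
Proof.
elim: p a => [|[x y] p IH] a /=; first exact: subdivision_start.
by move=> [ax c] c2; split=> //; exact: IH.
Qed.

Lemma subdivision_rev a b p : subdiv t a b p ->
  exists2 q, subdiv t b a q & len q = len p.
Proof.
elim: p a => [|[x y] p IH] a /=.
  by move=> ab; exists [::] => //=; exact: fold_equiv_sym.
move=> [ax /IH[q c lq]]; exists (q ++ [:: (y, x)]).
  apply: (subdivision_cat c); split; first exact: fold_equiv_refl.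
  exact: fold_equiv_sym.
rewrite subdivision_length_cat !subdivision_length_cons.
by rewrite subdivision_length_nil (tree_dC td y) lq; lra.
Qed.

Lemma fold_pdist_le a b p : subdiv t a b p -> fold_pdist t a b <= len p.
Proof.
move=> c; apply: ge_inf; last by exists p.
by exists 0 => _ [q _ <-]; exact: len_ge0.
Qed.

Lemma fold_pdist_glb c a b : (forall p, subdiv t a b p -> c <= len p) ->
  c <= fold_pdist t a b.
Proof.
move=> h; apply: lb_le_inf; last by move=> _ [p c' <-]; exact: h.
by exists (len [:: (a, b)]), [:: (a, b)] => //=; split; exact: fold_equiv_refl.
Qed.

Lemma fold_pdist_ge0 a b : 0 <= fold_pdist t a b.
Proof. by apply: fold_pdist_glb => p _; exact: len_ge0. Qed.

Lemma fold_pdist_equiv a b : sim t a b -> fold_pdist t a b = 0.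
Proof.
move=> ab; apply/eqP; rewrite eq_le fold_pdist_ge0 andbT.
by rewrite -(@subdivision_length_nil R T); exact: fold_pdist_le.
Qed.

Lemma fold_pdistC a b : fold_pdist t a b = fold_pdist t b a.
Proof.
apply/eqP; rewrite eq_le; apply/andP; split; apply: fold_pdist_glb => p;
by move=> /subdivision_rev[q c <-]; exact: fold_pdist_le.
Qed.

Lemma fold_pdist_tri b a c :
  fold_pdist t a c <= fold_pdist t a b + fold_pdist t b c.
Proof.
rewrite -lerBlDr; apply: fold_pdist_glb => p cp.
rewrite lerBlDr addrC -lerBlDr; apply: fold_pdist_glb => q cq.
rewrite lerBlDr addrC -subdivision_length_cat.
exact/fold_pdist_le/(subdivision_cat cp cq).
Qed.

Lemma fold_pdist_mdist a b : fold_pdist t a b <= mdist a b.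
Proof.
rewrite (_ : mdist a b = len [:: (a, b)]); last first.
  by rewrite subdivision_length_cons subdivision_length_nil addr0.
by apply: fold_pdist_le; split; exact: fold_equiv_refl.
Qed.

(** Along a subdivision the jumps cost [delta] nothing and each piece at most its length. This
    maximality identifies the minimal [delta] with the folded distance, and compares the foldings at
    [t] and [s + t]. *)
Lemma fold_pdist_max (delta : T -> T -> R) : tree_dist delta ->
  (forall a b, delta a b <= mdist a b) ->
  (forall a b, sim t a b -> delta a b = 0) ->
  forall a b, delta a b <= fold_pdist t a b.
Proof.
move=> tdelta le_delta delta0 a b; apply: fold_pdist_glb => p.
elim: p a => [|[x y] p IH] a /=.
  by move=> /delta0 ->; exact: len_ge0.
move=> [/delta0 ax /IH yb]; rewrite subdivision_length_cons.
have := tree_tri tdelta x a b; have := tree_tri tdelta y x b.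
by have := le_delta x y; lra.
Qed.

(** [[a, b]] is covered by the jumps and pieces of the subdivision. The pieces move the image by at
    most their total length, and the jump containing [w] adds at most [t]. For length 0 this is the
    bound defining [sim t]. *)
Lemma subdivision_excursion a b p w : subdiv t a b p ->
  segment mdist a b w -> mdist (f a) (f w) <= len p + t.
Proof.
elim: p a => [|[x y] p IH] a /=.
  by move=> /fold_equiv_mdistP[_ h] /h; rewrite subdivision_length_nil add0r.
move=> [/fold_equiv_mdistP[fax h] c]; rewrite subdivision_length_cons.
have := len_ge0 p; have xy := mdist_ge0 x y; have := t0 => ? lp.
move=> /(segment_cover td x)[/h|]; first lra.
rewrite fax => /(segment_cover td y)[|/(IH _ c)].
  rewrite /segment/=; have := mdist_ge0 w y.
  by have := lipf x w; lra.
have := tree_tri td' (f y) (f x) (f w).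
by have := lipf x y; lra.
Qed.

Lemma fold_pdist_excursion a b w : segment mdist a b w ->
  mdist (f a) (f w) <= fold_pdist t a b + t.
Proof.
move=> abw; rewrite -lerBlDr; apply: fold_pdist_glb => p c.
by rewrite lerBlDr; exact: subdivision_excursion abw.
Qed.

Lemma fold_pdist_f a b : mdist (f a) (f b) <= fold_pdist t a b.
Proof.
apply: fold_pdist_glb => p; elim: p a => [|[x y] p IH] a /=.
  by move=> /fold_equiv_mdistP[-> _]; rewrite mdistxx subdivision_length_nil.
move=> [/fold_equiv_mdistP[-> _] /IH]; rewrite subdivision_length_cons.
have := tree_tri td' (f y) (f x) (f b).
by have := lipf x y; lra.
Qed.

Lemma fold_pdist_eq0 a b : fold_pdist t a b = 0 -> sim t a b.
Proof.
move=> ab0; apply/fold_equiv_mdistP; split.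
  apply: mdist_positivity; have := fold_pdist_f a b.
  by have := mdist_ge0 (f a) (f b); lra.
by move=> w /fold_pdist_excursion; rewrite ab0 add0r.
Qed.

(** Near the turn both edges descend along the same part of [[f y, f a0]], so points at equal depth
    have equal images. They are also [sim t], because above height [s] the bound [s + t] on heights
    leaves room for excursions of at most [t]. *)
Lemma fold_turn (delta : T -> T -> R) a0 b0 s x y x' y' :
  turn f delta a0 b0 s x y x' y' ->
  (forall w, segment mdist a0 b0 w -> mdist (f a0) (f w) <= s + t) ->
  sim t y x' ->
  exists e Y Z, [/\ 0 < e,
    segment mdist x y Y /\ mdist y Y = e,
    segment mdist x' y' Z /\ mdist x' Z = e &
    forall p q, segment mdist y Y p -> segment mdist x' Z q ->
      mdist y p = mdist x' q -> sim t p q].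
Proof.
move=> [[ax ay xy0 fxy] [ax' ay' xy0' fxy'] _ _ [sy hxy hxy']] hmax.
move=> /fold_equiv_mdistP[fyx' yx'].
(* [g] and [g'] are Gromov products at [f y]: how far the images of the two edges follow
   [[f y, f a0]]. The first term of [e] keeps the folded part at height at least [s]. *)
pose g := (mdist x y + mdist (f a0) (f y) - mdist (f a0) (f x)) / 2.
pose g' := (mdist x' y' + mdist (f a0) (f y) - mdist (f a0) (f y')) / 2.
pose e := Num.min (mdist (f a0) (f y) - s) (Num.min g g').
have e0 : 0 < e by rewrite !lt_min /g /g'; lra.
have es : e <= mdist (f a0) (f y) - s by rewrite ge_min lexx.
have eg : e <= g by rewrite !ge_min lexx orbT.
have eg' : e <= g' by rewrite !ge_min lexx !orbT.
have yx := tree_dC td y x.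
have fyx := tree_dC td' (f y) (f x).
have t1 := tree_tri td' (f x) (f a0) (f y).
have t2 := tree_tri td' (f y') (f a0) (f y).
have fyy' := tree_dC td' (f y') (f y).
have [|Y yY Yx] := @Rtree_geodesic R T y x e treeT.
  by move: eg; rewrite /g; lra.
have [|Z xZ Zy] := @Rtree_geodesic R T x' y' e treeT.
  by rewrite fyx' in t2 fyy' eg'; move: eg'; rewrite /g' fyx'; lra.
exists e, Y, Z; split=> //.
  by split=> //; apply: segment_sym => //; rewrite /segment/=; lra.
  by split=> //; rewrite /segment/=; lra.
move=> p q yYp xZq ypxq.
have yxp : segment mdist y x p.
  by apply: (segment_convex td _ _ yYp);
    [exact: segment_refl|rewrite /segment/=; lra].
have xyq : segment mdist x' y' q.
  by apply: (segment_convex td _ _ xZq);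
    [exact: segment_refl|rewrite /segment/=; lra].
have fyx_iso : mdist (f y) (f x) = mdist y x by rewrite fyx yx.
have fyp : mdist (f y) (f p) = mdist y p.
  exact: (isometric_subsegment treeT treeT' morf fyx_iso (segment_refl td _ _)).
have fpx : mdist (f p) (f x) = mdist p x.
  exact: (isometric_subsegment treeT treeT' morf fyx_iso _ (segment_reflr td _ _)).
have fxq : mdist (f y) (f q) = mdist x' q.
  rewrite fyx'.
  exact: (isometric_subsegment treeT treeT' morf fxy' (segment_refl td _ _)).
have fqy : mdist (f q) (f y') = mdist q y'.
  exact: (isometric_subsegment treeT treeT' morf fxy' _ (segment_reflr td _ _)).
have ype : mdist y p <= e.
  by move: yYp; rewrite /segment/= yY; have := mdist_ge0 p Y; lra.
have hp : mdist (f a0) (f p) <= mdist (f a0) (f y) - mdist y p.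
  have := tree_dC td' (f p) (f x); have := tree_dC td' (f p) (f y).
  move: yxp eg; rewrite /segment/= /g.
  by case: (tree_d4P td' (f a0) (f p) (f y) (f x)) => *; lra.
have hq : mdist (f a0) (f q) <= mdist (f a0) (f y) - mdist y p.
  have := tree_dC td' (f q) (f y).
  rewrite -fyx' in fxy'.
  move: xyq eg'; rewrite /segment/= /g'.
  by case: (tree_d4P td' (f a0) (f q) (f y) (f y')) => *; lra.
have pa := tree_dC td' (f p) (f a0); have qy := tree_dC td' (f q) (f y).
have py := tree_dC td' (f p) (f y); have qa := tree_dC td' (f q) (f a0).
have fpq : f p = f q.
  apply: mdist_positivity; have := mdist_ge0 (f p) (f q).
  by case: (tree_d4P td' (f p) (f q) (f a0) (f y)) => *; lra.
have hy := hmax y ay.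
apply/fold_equiv_mdistP; split=> // w.
move=> /(segment_cover td y)[pyw|/(segment_cover td x')[yxw|xqw]].
- have := lipf p w; have := mdist_ge0 w y.
  by move: pyw; have := tree_dC td p y; rewrite /segment/=; lra.
(* Between [y] and [x'], the image of [w] is within [t] of [f y] and within [s + t] of [f a0], while
   [f p] lies on [[f a0, f y]] at height at least [s]. *)
- have hw := hmax w (segment_convex td ay ax' yxw); have hw' := yx' w yxw.
  have yw := tree_dC td' (f y) (f w); have pw := tree_dC td' (f p) (f w).
  have wa := tree_dC td' (f w) (f a0); have := mdist_ge0 y p.
  by case: (tree_d4P td' (f p) (f w) (f a0) (f y)) => *; lra.
- rewrite fpq; have := lipf q w; have := mdist_ge0 x' w.
  by have := tree_dC td q w; move: xqw; rewrite /segment/=; lra.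
Qed.

End FoldMetric.

(** By totality a single member of [F] is close to the infimum at all four pairs on the right of the
    four-point inequality. *)
Lemma tree_dist_inf (R : realType) (T : Type) (F : set (T -> T -> R)) :
  (F !=set0)%classic -> (forall d, F d -> tree_dist d) ->
  (forall d d', F d -> F d' ->
     (forall x y, d x y <= d' x y) \/ (forall x y, d' x y <= d x y)) ->
  tree_dist (fun x y => inf [set d x y | d in F]%classic).
Proof.
move=> [d0 Fd0] treeF totF; set I := fun x y => inf _.
have I_le x y d : F d -> I x y <= d x y.
  move=> Fd; apply: ge_inf; last by exists d.
  by exists 0 => _ [d1 /treeF td1 <-]; exact: tree_ge0.
have I_near x y e : 0 < e -> exists2 d, F d & d x y < I x y + e.
  move=> e0; have [||_ [d Fd <-] h] :=
    @inf_adherent R [set d x y | d in F]%classic e.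
  - by [].
  - split; first by exists (d0 x y), d0.
    by exists 0 => _ [d1 /treeF td1 <-]; exact: tree_ge0.
  - by exists d.
have I_near2 x y z w e : 0 < e -> exists2 d, F d &
    d x y < I x y + e /\ d z w < I z w + e.
  move=> e0; have [d1 F1 h1] := I_near x y e e0.
  have [d2 F2 h2] := I_near z w e e0.
  by have [le12|le21] := totF _ _ F1 F2; [exists d1|exists d2] => //; split=> //;
    apply: le_lt_trans; eauto.
split=> [x|x y|x y z w].
- apply/eqP; rewrite eq_le; apply/andP; split.
    by rewrite -(tree_dxx (treeF _ Fd0) x); exact: I_le.
  apply: lb_le_inf; first by exists (d0 x x), d0.
  by move=> _ [d /treeF td <-]; exact: tree_ge0.
- by congr inf; apply/seteqP; split=> _ [d Fd <-]; exists d => //;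
    exact: (tree_dC (treeF _ Fd)).
- apply/ler_addgt0Pr => e e0; have e20 : 0 < e / 2 by lra.
  have [d1 F1 [h1 h1']] := I_near2 x z y w _ e20.
  have [d2 F2 [h2 h2']] := I_near2 x w y z _ e20.
  have [d Fd [[k1 k1'] [k2 k2']]] : exists2 d, F d &
    (d x z < I x z + e / 2 /\ d y w < I y w + e / 2) /\
    (d x w < I x w + e / 2 /\ d y z < I y z + e / 2).
    by have [le12|le21] := totF _ _ F1 F2; [exists d1|exists d2] => //;
      do !split=> //; apply: le_lt_trans; eauto.
  have := I_le x y d Fd; have := I_le z w d Fd.
  rewrite -lerBlDr le_max => ? ?; apply/orP.
  by case: (tree_d4P (treeF _ Fd) x y z w) => ?; [left|right]; lra.
Qed.

(** * Folding two segments of a 0-hyperbolic pseudo-distance *)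

Section Pinch.
Context {R : realType} {T : Type}.
Variables (d : T -> T -> R) (td : tree_dist d) (o : T).

Definition gromov (u v : T) : R := (d o u + d o v - d u v) / 2.

Variable m : T -> R.
(** [m] behaves like the Gromov product at [o] with one further point: [m_le] keeps the diagonal of
    [pinch] at 0, and [m_ge] is the ultrametric inequality. *)
Hypothesis m_le : forall u, m u <= d o u.
Hypothesis m_ge : forall u v, Num.min (gromov u v) (m v) <= m u.

(* Raising the Gromov product at o of points u and v to min (m u) (m v) keeps
   it ultrametric.  When m u is the length, capped at e, along which [o, u]
   follows one of two given segments issued from o, this folds these two
   segments onto each other up to distance e. *)
Definition pinched_gromov (u v : T) : R :=
  Num.max (gromov u v) (Num.min (m u) (m v)).

Definition pinch (u v : T) : R := d o u + d o v - 2 * pinched_gromov u v.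

Lemma gromov_ultra v u w : gromov u v <= gromov u w \/ gromov v w <= gromov u w.
Proof.
have := tree_dC td u o; have := tree_dC td v o; have := tree_dC td w o.
have := tree_dC td w v; rewrite /gromov.
by case: (tree_d4P td u w v o) => *; [left|right]; lra.
Qed.

Lemma pinched_gromovC u v : pinched_gromov u v = pinched_gromov v u.
Proof.
rewrite /pinched_gromov minC /gromov (tree_dC td u v).
by rewrite (addrC (d o u)).
Qed.

Lemma pinched_gromov_ultra v u w :
  pinched_gromov u v <= pinched_gromov u w \/
  pinched_gromov v w <= pinched_gromov u w.
Proof.
have H := gromov_ultra v u w.
have m1 := m_ge u v; have m2 := m_ge w v.
have gwv : gromov w v = gromov v w.
  by rewrite /gromov (tree_dC td v w) (addrC (d o v)).
rewrite gwv in m2; rewrite /pinched_gromov.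
have [|h1] := leP; [by left|right]; have [//|h2] := leP; exfalso.
move: h1 h2 m1 m2; rewrite !lt_max !lt_min !gt_max !gt_min !ge_min.
by case: H => ?; lra.
Qed.

Lemma pinch_tree : tree_dist pinch.
Proof.
split=> [x|x y|x y z w].
- rewrite /pinch /pinched_gromov minxx /gromov (tree_dxx td).
  by have := m_le x; case: (leP _ (m x)); lra.
- by rewrite /pinch pinched_gromovC (addrC (d o x)).
(* Distances to [o] cancel: the claim is that [(x|y) + (z|w)] is at least the smaller of
   [(x|z) + (y|w)] and [(x|w) + (y|z)] for the pinched products. *)
- have u1 := pinched_gromov_ultra z x y; have u2 := pinched_gromov_ultra w x y.
  have u3 := pinched_gromov_ultra x z w; have u4 := pinched_gromov_ultra y z w.
  rewrite (pinched_gromovC z y) in u1; rewrite (pinched_gromovC w y) in u2.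
  rewrite (pinched_gromovC z x) in u3; rewrite (pinched_gromovC z y) in u4.
  rewrite /pinch leNgt gt_max; apply/negP => /andP[].
  by case: u1 => ?; case: u2 => ?; case: u3 => ?; case: u4 => ?; lra.
Qed.

Lemma pinch_le u v : pinch u v <= d u v.
Proof.
have : gromov u v <= pinched_gromov u v by rewrite le_max lexx.
by rewrite /pinch /gromov; lra.
Qed.

End Pinch.

(** * The pulled-back distance of [T_t] is 0-hyperbolic *)

Section FoldTree.
Context {R : realType} {T T' : metricType R}.
Variables (f : T -> T') (treeT : Rtree T) (treeT' : Rtree T').
Variable morf : tree_morphism f.
Variables (t : R) (t0 : 0 <= t).

Let td := mdist_tree treeT.
Let td' := mdist_tree treeT'.

Local Notation sim := (fold_equiv (@mdist R T) (@mdist R T') f).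
Local Notation D := (fold_pdist f t).

Definition above_fold (delta : T -> T -> R) : Prop :=
  [/\ tree_dist delta, forall x y, D x y <= delta x y
    & forall x y, delta x y <= mdist x y].

Lemma above_fold_minimal : exists2 delta, above_fold delta &
  forall delta', above_fold delta' ->
    (forall x y, delta' x y <= delta x y) -> delta' = delta.
Proof.
pose X := {delta | above_fold delta}.
(* The order is reversed, so that Zorn's maximal element is a minimal pseudo-distance. *)
pose rel (d1 d2 : X) := `[< forall x y, sval d2 x y <= sval d1 x y >].
have [||||[delta ad] min_delta] := @Zorn X rel.
- by move=> d1; apply/asboolP.
- move=> d1 d2 d3 /asboolP h1 /asboolP h2; apply/asboolP => x y.
  exact: le_trans (h2 x y) (h1 x y).
- move=> [d1 a1] [d2 a2] /asboolP/= h1 /asboolP/= h2; apply: eq_exist.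
  apply/funext => x; apply/funext => y; apply/eqP.
  by rewrite eq_le h1 h2.
- move=> A totA; have [[d0 Ad0]|A0] := pselect (A !=set0)%classic; last first.
    have am : above_fold (@mdist R T).
      by split=> //; exact: fold_pdist_mdist.
    by exists (exist _ _ am) => d1 Ad1; exfalso; apply: A0; exists d1.
  pose F := [set sval d | d in A]%classic.
  have lb x y : has_lbound [set d x y | d in F]%classic.
    exists 0 => _ [_ [d1 _ <-] <-]; case: (svalP d1) => td1 _ _.
    exact: tree_ge0.
  have ai : above_fold (fun x y => inf [set d x y | d in F]%classic).
    split.
    + apply: tree_dist_inf.
      * by exists (sval d0), d0.
      * by move=> _ [d1 _ <-]; case: (svalP d1).
      * move=> _ _ [d1 A1 <-] [d2 A2 <-].
        by have [/asboolP|/asboolP] := totA d1 d2 A1 A2; [right|left].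
    + move=> x y; apply: lb_le_inf.
        by exists (sval d0 x y), (sval d0) => //; exists d0.
      by move=> _ [_ [d1 _ <-] <-]; case: (svalP d1).
    + move=> x y; case: (svalP d0) => _ _ /(_ x y); apply: le_trans.
      by apply: ge_inf => //; exists (sval d0) => //; exists d0.
  exists (exist _ _ ai) => d1 Ad1; apply/asboolP => x y /=.
  by apply: ge_inf => //; exists (sval d1) => //; exists d1.
- exists delta => // delta' ad' le_delta.
  have := min_delta (exist _ _ ad'); rewrite /rel/= => h.
  by apply: (congr1 sval (h _)); apply/asboolP.
Qed.

(** The pinched distance stays above [D]: where the product is raised to [r], [u] and [v] can be
    joined through the points [p] and [q] at distance [r] from [o], and passing between these costs
    [D] nothing. *)
Lemma fold_pdist_pinch (delta : T -> T -> R) (o Y Z : T) (e : R) :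
  above_fold delta -> delta o Z = e -> 0 <= e ->
  (forall r, 0 <= r <= e -> exists p q,
     [/\ delta o p <= r /\ delta p Y <= e - r,
         delta o q <= r /\ delta q Z <= e - r & D p q = 0]) ->
  delta o Y = e ->
  let m u := Num.min e (Num.max (gromov delta o u Y) (gromov delta o u Z)) in
  above_fold (pinch delta o m) /\ pinch delta o m Y Z <= 0.
Proof.
move=> [tdelta D_delta delta_d] oZ e0 folded oY m.
have Dtri := @fold_pdist_tri R T T' f treeT treeT' morf t t0.
have DC := @fold_pdistC R T T' f treeT treeT' morf t t0.
have tri := tree_tri tdelta; have dC := tree_dC tdelta.
have ultra := gromov_ultra tdelta o.
have m_le u : m u <= delta o u.
  rewrite /m ge_min ge_max; apply/orP; right.
  rewrite /gromov; have := tri u o Y; have := tri u o Z.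
  by lra.
have m_ge u v : Num.min (gromov delta o u v) (m v) <= m u.
  rewrite /m; set a := gromov delta o u v.
  have hY := ultra v u Y; have hZ := ultra v u Z.
  rewrite -/a in hY hZ.
  rewrite !ge_min !le_min !le_max !ge_max.
  by case: hY => ?; case: hZ => ?; lra.
have YZ : pinch delta o m Y Z <= 0.
  have mY : e <= m Y.
    by rewrite /m le_min le_max lexx /gromov oY (tree_dxx tdelta); lra.
  have mZ : e <= m Z.
    by rewrite /m le_min !le_max lexx /gromov oZ (tree_dxx tdelta); lra.
  have : e <= pinched_gromov delta o m Y Z.
    by rewrite /pinched_gromov le_max le_min mY mZ orbT.
  by rewrite /pinch oY oZ; lra.
split=> //; split; first exact: pinch_tree.
  move=> u v; rewrite /pinch /pinched_gromov.
  have [_|lt_min] := leP (Num.min (m u) (m v)) (gromov delta o u v).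
    by have := D_delta u v; rewrite /gromov; lra.
  set r := Num.min (m u) (m v) in lt_min *.
  have g0 : 0 <= gromov delta o u v.
    by have := tri o u v; rewrite /gromov (dC u o); lra.
  have ru : r <= m u by rewrite ge_min lexx.
  have rv : r <= m v by rewrite ge_min lexx orbT.
  have re : r <= e by apply: (le_trans ru); rewrite ge_min lexx.
  have [|p [q [[op pY] [oq qZ] pq]]] := folded r; first lra.
  (* [r <= m w] means that [[o, w]] follows [[o, Y]] or [[o, Z]] up to distance [r], hence passes by
     [p] or [q]. *)
  have near w : r <= m w ->
      delta w p <= delta o w - r \/ delta w q <= delta o w - r.
    rewrite /m le_min le_max => /andP[_ /orP[]]; rewrite /gromov => h.
      left; have := dC w o; have := dC p o.
      by case: (tree_d4P tdelta w p o Y) => *; lra.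
    right; have := dC w o; have := dC q o.
    by case: (tree_d4P tdelta w q o Z) => *; lra.
  have Dp w w' := D_delta w w'.
  have vp := dC v p; have vq := dC v q; have qp := DC q p.
  case: (near u ru) => h1; case: (near v rv) => h2.
  - by have := Dtri p u v; have := Dp u p; have := Dp p v; lra.
  - have := Dtri p u v; have := Dp u p; have := Dtri q p v.
    by have := Dp q v; lra.
  - have := Dtri q u v; have := Dp u q; have := Dtri p q v.
    by have := Dp p v; lra.
  - by have := Dtri q u v; have := Dp u q; have := Dp q v; lra.
by move=> u v; apply: le_trans (delta_d u v); exact: pinch_le.
Qed.

Lemma minimal_fold_equiv0 (delta : T -> T -> R) : above_fold delta ->
  (forall delta', above_fold delta' ->
    (forall x y, delta' x y <= delta x y) -> delta' = delta) ->
  forall a b, sim t a b -> delta a b = 0.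
Proof.
move=> ad min_delta a b ab; have [tdelta D_delta delta_d] := ad.
have f_delta x y : mdist (f x) (f y) <= delta x y.
  exact: le_trans (fold_pdist_f treeT treeT' morf t0 x y) (D_delta x y).
have [fab hab] := (fold_equiv_mdistP treeT treeT' morf t a b).1 ab.
apply/eqP; rewrite eq_le tree_ge0// andbT leNgt; apply/negP => ab0.
have [[|[x y] p]] := chain_exists treeT treeT' morf tdelta delta_d f_delta a b.
  by rewrite subdivision_length_nil => _; lra.
move=> /= [ax exy c] lp.
have fax : f a = f x by apply: (delta0_f treeT' f_delta).
(* Level 0: the chain starts and ends over [f a], and the end [y] of its first edge has height
   [mdist x y > 0]. *)
have [x1 [y1 [x2 [y2 tn]]]] : exists x y x' y', turn f delta a b 0 x y x' y'.
  apply: (@turn_exists R T T' f treeT' delta tdelta delta_d f_delta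
            a b 0 a y b [:: (x, y)] p) => //.
  - by split=> //=; exact: tree_dxx.
  - by move: lp; rewrite !subdivision_length_cons subdivision_length_nil; lra.
  - by rewrite (tree_dxx td').
  - by rewrite fax; case: exy => _ _ ? ->.
  - by rewrite fab (tree_dxx td').
have [e1 e2 y1x2 opt _] := tn.
have y1x2_sim : sim t y1 x2.
  apply: (fold_pdist_eq0 treeT treeT' morf t0); apply/eqP.
  rewrite eq_le (fold_pdist_ge0 treeT treeT' morf t0) andbT.
  by rewrite -y1x2.
have [|e [Y [Z [e0 [xyY yY] [xyZ xZ] foldYZ]]]] :=
    fold_turn treeT treeT' morf tn _ y1x2_sim.
  by move=> w /hab; rewrite add0r.
have iso x' y' u v : edge f a b x' y' -> segment mdist x' y' u ->
    segment mdist x' y' v -> delta u v = mdist u v.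
  move=> [_ _ _ fxy] xu xv; apply/eqP; rewrite eq_le delta_d /=.
  by rewrite -(isometric_subsegment treeT treeT' morf fxy xu xv).
have y1Y : delta y1 Y = e.
  by rewrite (iso x1 y1) //; exact: segment_reflr.
have x2Z : delta x2 Z = e.
  by rewrite (iso x2 y2) //; exact: segment_refl.
have y1Z : delta y1 Z = e.
  have := tree_tri tdelta x2 y1 Z; have := tree_tri tdelta y1 x2 Z.
  by have := tree_dC tdelta x2 y1; lra.
have [r re|/= ap YZ0] := fold_pdist_pinch ad y1Z (ltW e0) _ y1Y.
  have [|p1 yp pY] := @Rtree_geodesic R T y1 Y r treeT; first by rewrite yY.
  have [|q1 xq qZ] := @Rtree_geodesic R T x2 Z r treeT; first by rewrite xZ.
  exists p1, q1; split.
  - by have := delta_d y1 p1; have := delta_d p1 Y; split; lra.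
  - have := delta_d x2 q1; have := delta_d q1 Z.
    by have := tree_tri tdelta x2 y1 q1; split; lra.
  - apply: (fold_pdist_equiv treeT treeT' morf t0); apply: foldYZ.
    + by rewrite /segment/=; lra.
    + by rewrite /segment/=; lra.
    + by rewrite yp xq.
(* By minimality pinching changes nothing, so [delta Y Z <= 0]; but [Y] and [Z] lie at distance [e]
   on either side of the turn of a [delta]-geodesic, so [delta Y Z >= 2 * e]. *)
move: YZ0; rewrite (min_delta _ ap); last by move=> u v; exact: pinch_le.
have := tree_tri tdelta Y x1 y2; have := tree_tri tdelta Z Y y2.
have := delta_d x1 Y; have := delta_d Z y2.
move: xyY xyZ; rewrite /segment/= (tree_dC td Y y1) yY xZ.
by lra.
Qed.

Lemma fold_pdist_tree : tree_dist D.
Proof.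
have [delta ad min_delta] := above_fold_minimal.
have [tdelta D_delta delta_d] := ad.
have delta0 := minimal_fold_equiv0 ad min_delta.
rewrite (_ : D = delta) //; apply/funext => a; apply/funext => b.
apply/eqP; rewrite eq_le D_delta /=.
exact: (fold_pdist_max treeT treeT' morf t0 tdelta delta_d delta0).
Qed.

End FoldTree.

(** * Folding by [s] after folding by [t], read on [T_0] *)

Section FoldTwice.
Context {R : realType} {T T' : metricType R}.
Variables (f : T -> T') (treeT : Rtree T) (treeT' : Rtree T').
Variable morf : tree_morphism f.
Variables (s t : R) (s0 : 0 <= s) (t0 : 0 <= t).

Let td := mdist_tree treeT.
Let td' := mdist_tree treeT'.

Local Notation len := (subdivision_length (@mdist R T)).
Local Notation sim := (fold_equiv (@mdist R T) (@mdist R T') f).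
Local Notation D := (fold_pdist f t).

Let tD := fold_pdist_tree treeT treeT' morf t0.
Let D_d := fold_pdist_mdist treeT treeT' morf t0.
Let f_D := fold_pdist_f treeT treeT' morf t0.

Lemma fold_segment_height a b c : sim (s + t) a b ->
  segment D a b c -> mdist (f a) (f c) <= s.
Proof.
move=> /(fold_equiv_mdistP treeT treeT' morf)[fab hab] acb.
rewrite leNgt; apply/negP => sc.
have [p cp lp] := chain_exists treeT treeT' morf tD D_d f_D a b.
have ac0 := tree_ge0 tD a c; have cb0 := tree_ge0 tD c b.
(* The chain need not contain [c], but its point [m] at the same [D]-distance from [a] is at
   [D]-distance 0 from [c], hence has the same image. *)
have [|m [p1 [p2 [c1 c2 l1 l2]]]] :=
    chain_split treeT treeT' morf tD (r := D a c) cp.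
  by move: acb; rewrite lp /segment/=; lra.
have am := chain_le tD D_d f_D c1; have mb := chain_le tD D_d f_D c2.
have amb : segment D a b m.
  by apply: (segmentW tD); move: acb; rewrite /segment/=; lra.
have fmc : f m = f c.
  apply: (delta0_f treeT' f_D); apply: (segment_eq0 tD amb acb).
  by move: acb amb; rewrite /segment/=; lra.
have [x [y [x' [y' tn]]]] : exists x y x' y', turn f D a b s x y x' y'.
  apply: (turn_exists treeT' tD D_d f_D c1 c2).
  - by rewrite l1 l2 lp; lra.
  - by rewrite (tree_dxx td').
  - by rewrite fmc.
  - by rewrite fab (tree_dxx td').
have [e1 e2 yx' opt _] := tn.
have [|e [Y [Z [e0 [xyY yY] [xyZ xZ] foldYZ]]]] :=
    fold_turn treeT treeT' morf tn hab.
  exact: (fold_pdist_eq0 treeT treeT' morf t0).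
have YZ0 : D Y Z = 0.
  apply: (fold_pdist_equiv treeT treeT' morf t0); apply: foldYZ.
  - exact: segment_reflr.
  - exact: segment_reflr.
  - by rewrite yY.
(* Jumping from [Y] to [Z] at no cost saves [2 * e] on a path that was already [D]-geodesic. *)
have := tree_tri tD Y x y'; have := tree_tri tD Z Y y'.
have := D_d x Y; have := D_d Z y'.
by move: xyY xyZ; rewrite /segment/= (tree_dC td Y y) yY xZ; lra.
Qed.

(** By optimality the edges lie on the [D]-segment, hence at height at most [s]. A jump starts at
    such a height and strays at most [t] from it, by the excursion bound. *)
Lemma chain_height a b u p : chain f D a b u b p ->
  D a u + len p <= D a b -> mdist (f a) (f u) <= s ->
  (forall c, segment D a b c -> mdist (f a) (f c) <= s) ->
  forall w, segment mdist u b w -> mdist (f a) (f w) <= s + t.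
Proof.
move=> + + + hs.
have jump v x w : D v x = 0 -> segment mdist v x w ->
    mdist (f a) (f v) <= s -> mdist (f a) (f w) <= s + t.
  move=> vx vxw hv.
  have := fold_pdist_excursion treeT treeT' morf t0 vxw.
  by rewrite vx; have := tree_tri td' (f v) (f a) (f w); lra.
elim: p u => [|[x y] p IH] u /=.
  by move=> ub _ hu w ubw; exact: jump ub ubw hu.
move=> [ux e c]; rewrite subdivision_length_cons => opt hu w.
have on_arc v : segment mdist x y v -> segment D a b v.
  rewrite {1}/segment/= => xyv; apply: (segmentW tD).
  have := tree_tri tD u a v; have := tree_tri tD x u v.
  have := tree_tri tD y v b; have := chain_le tD D_d f_D c.
  by have := D_d x v; have := D_d v y; lra.
move=> /(segment_cover td x)[uxw|/(segment_cover td y)[xyw|]].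
- exact: jump ux uxw hu.
- by have := hs w (on_arc w xyw); have := t0; lra.
- apply: (IH y c); last exact/hs/on_arc/segment_reflr.
  have := tree_tri tD u a y; have := tree_tri tD x u y.
  by have := D_d x y; lra.
Qed.

Lemma fold_equiv_addP a b : sim (s + t) a b <->
  f a = f b /\ forall c, segment D a b c -> mdist (f a) (f c) <= s.
Proof.
split=> [ab|[fab hs]].
  split; first by case: ab.
  by move=> c; exact: fold_segment_height.
apply/fold_equiv_mdistP => //; split=> // w.
have [p cp lp] := chain_exists treeT treeT' morf tD D_d f_D a b.
apply: (chain_height cp) => //; first by rewrite lp (tree_dxx tD); lra.
by rewrite (tree_dxx td').
Qed.

End FoldTwice.

(** * Classes and representatives *)

Section Quotient.
Context {R : realType} {T T' : Type}.
Variables (d : T -> T -> R) (d' : T' -> T' -> R) (f : T -> T') (t : R).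

Local Notation sim := (fold_equiv d d' f t).
Local Notation phi := (Phi d d' f t).

Lemma fold_reprK (C : fold_tree d d' f t) : phi (fold_repr C) = C.
Proof.
rewrite /fold_repr; case: (cid _) => a /= Ca.
by case: C Ca => C eC /= Ca; apply: eq_exist => /=.
Qed.

Hypothesis fold_equiv_refl : forall a, sim a a.
Hypothesis fold_equiv_sym : forall a b, sim a b -> sim b a.
Hypothesis fold_equiv_trans : forall a b c, sim a b -> sim b c -> sim a c.

Lemma Phi_eqP a b : phi a = phi b <-> sim a b.
Proof.
split=> [/(congr1 sval)/= ab|ab].
  have : [set c | sim b c]%classic b by exact: fold_equiv_refl.
  by rewrite -ab.
apply: eq_exist; apply/seteqP; split=> c /=; last exact: fold_equiv_trans.
by apply: fold_equiv_trans; exact: fold_equiv_sym.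
Qed.

Lemma fold_repr_Phi a : sim (fold_repr (phi a)) a.
Proof. by apply/Phi_eqP; rewrite fold_reprK. Qed.

End Quotient.

(** * The iterated quotient and its distance *)

Section FoldedTree.
Context {R : realType} {T T' : metricType R}.
Variables (f : T -> T') (treeT : Rtree T) (treeT' : Rtree T').
Variable morf : tree_morphism f.

Let d : T -> T -> R := mdist.
Let d' : T' -> T' -> R := mdist.
Let td' := mdist_tree treeT'.

Local Notation sim := (fold_equiv d d' f).
Local Notation phi := (Phi d d' f).

Lemma Phi_mdist_eqP u a b : 0 <= u -> phi u a = phi u b <-> sim u a b.
Proof.
move=> u0; apply: Phi_eqP.
- exact: fold_equiv_refl.
- exact: fold_equiv_sym.
- exact: fold_equiv_trans.
Qed.

Lemma fold_repr_Phi_mdist u a : 0 <= u -> sim u (fold_repr (phi u a)) a.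
Proof. by move=> u0; apply/Phi_mdist_eqP => //; rewrite fold_reprK. Qed.

Lemma fold_pdist_compat u a a' b b' : 0 <= u -> sim u a a' -> sim u b b' ->
  fold_pdist f u a b = fold_pdist f u a' b'.
Proof.
move=> u0 /(fold_pdist_equiv treeT treeT' morf u0) aa'.
move=> /(fold_pdist_equiv treeT treeT' morf u0) bb'.
have tD := fold_pdist_tree treeT treeT' morf u0.
have := tree_dC tD a a'; have := tree_dC tD b b'.
have := tree_tri tD a' a b; have := tree_tri tD b' a' b.
have := tree_tri tD a a' b'; have := tree_tri tD b a b'.
by lra.
Qed.

Lemma fold_dist_Phi u a b : 0 <= u ->
  fold_dist d d' f u (phi u a) (phi u b) = fold_pdist f u a b.
Proof.
by move=> u0; apply: fold_pdist_compat => //; exact: fold_repr_Phi_mdist.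
Qed.

Variables (s t : R) (s0 : 0 <= s) (t0 : 0 <= t).

Let dt := fold_dist d d' f t.
Let psit := Psi d d' f t.
Let st0 : 0 <= s + t := addr_ge0 s0 t0.
Let tD := fold_pdist_tree treeT treeT' morf t0.

Local Notation sims := (fold_equiv dt d' psit s).

Lemma fold_dist_tree : tree_dist dt.
Proof.
split=> [X|X Y|X Y Z W].
- exact: (tree_dxx tD).
- exact: (tree_dC tD).
- exact: (tree_d4 tD).
Qed.

Lemma fold_twice_equivP X Y :
  sims X Y <-> sim (s + t) (fold_repr X) (fold_repr Y).
Proof.
have lip X1 Y1 : d' (psit X1) (psit Y1) <= dt X1 Y1.
  exact: (fold_pdist_f treeT treeT' morf t0).
have P := fold_equivP s X Y fold_dist_tree (tree_dC td') lip.
have Q := fold_equiv_addP treeT treeT' morf s0 t0 (fold_repr X) (fold_repr Y).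
split=> [/P[fXY h]|/Q[fXY h]].
  apply/Q; split=> // c XcY; have <- : psit (phi t c) = f c.
    by case: (fold_repr_Phi_mdist c t0).
  apply: h; rewrite -(fold_reprK X) -(fold_reprK Y).
  by rewrite /segment/= /dt !fold_dist_Phi.
apply/P; split=> // C; exact: h.
Qed.

Lemma fold_twice_equiv_Phi a b : sims (phi t a) (phi t b) <-> sim (s + t) a b.
Proof.
have tst : t <= s + t by rewrite lerDr.
have r c : sim (s + t) (fold_repr (phi t c)) c.
  exact: (fold_equiv_le treeT treeT' morf tst (fold_repr_Phi_mdist c t0)).
split=> [/fold_twice_equivP ab|ab]; last apply/fold_twice_equivP.
  apply: (fold_equiv_trans treeT treeT' morf _ (r b)).
  apply: (fold_equiv_trans treeT treeT' morf _ ab).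
  by apply: fold_equiv_sym => //; exact: r.
apply: (fold_equiv_trans treeT treeT' morf (r a)).
apply: (fold_equiv_trans treeT treeT' morf ab).
by apply: fold_equiv_sym => //; exact: r.
Qed.

Local Notation phis := (Phi dt d' psit s).

Lemma Phi_twice_eqP X Y : phis X = phis Y <-> sims X Y.
Proof.
apply: Phi_eqP => [A|A B|A B C].
- by apply/fold_twice_equivP; exact: fold_equiv_refl.
- by move=> /fold_twice_equivP h; apply/fold_twice_equivP; exact: fold_equiv_sym.
- move=> /fold_twice_equivP h /fold_twice_equivP h'.
  by apply/fold_twice_equivP; exact: fold_equiv_trans h h'.
Qed.

Lemma fold_repr_Phi_twice X : sims (fold_repr (phis X)) X.
Proof. by apply/Phi_twice_eqP; rewrite fold_reprK. Qed.

(** An [(s + t)]-subdivision in [T_0] maps to an [s]-subdivision in [T_t] that is no longer.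
    Conversely, the jumps of an [s]-subdivision in [T_t] have length 0 for the [(s + t)]-distance,
    and its pieces do not get longer. *)
Lemma fold_dist_twice X Y :
  inf [set subdivision_length dt P | P in
        [set P | subdivision dt d' psit s X Y P]]%classic =
  fold_pdist f (s + t) (fold_repr X) (fold_repr Y).
Proof.
set I := inf _.
have tDs := fold_pdist_tree treeT treeT' morf st0.
have le_D a b : fold_pdist f (s + t) a b <= fold_pdist f t a b.
  apply: (fold_pdist_max treeT treeT' morf t0 tDs).
    exact: (fold_pdist_mdist treeT treeT' morf st0).
  move=> x y xy; apply: (fold_pdist_equiv treeT treeT' morf st0).
  by apply: (fold_equiv_le treeT treeT' morf _ xy); rewrite lerDr.
have len0 P : 0 <= subdivision_length dt P.
  by apply: sumr_ge0 => -[A B] _; exact: (tree_ge0 fold_dist_tree).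
have sims_dist A B : sims A B ->
    fold_pdist f (s + t) (fold_repr A) (fold_repr B) = 0.
  by move=> /fold_twice_equivP/(fold_pdist_equiv treeT treeT' morf st0).
have map_sub a p X' : subdivision d d' f (s + t) a (fold_repr Y) p ->
    sims X' (phi t a) -> exists2 P,
      subdivision dt d' psit s X' Y P &
      subdivision_length dt P <= subdivision_length d p.
  elim: p a X' => [|[x y] p IH] a X' /=.
    move=> /fold_twice_equiv_Phi aY Xa; exists [::] => /=; last first.
      by rewrite /subdivision_length !big_nil.
    apply/Phi_twice_eqP; move/Phi_twice_eqP: aY; rewrite fold_reprK => <-.
    exact/Phi_twice_eqP.
  move=> [/fold_twice_equiv_Phi/Phi_twice_eqP ax c] /Phi_twice_eqP Xa.
  have [|P cP lP] := IH y (phi t y) c; first by apply/Phi_twice_eqP.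
  exists ((phi t x, phi t y) :: P).
    by split=> //; apply/Phi_twice_eqP; rewrite Xa.
  rewrite /subdivision_length !big_cons lerD//= /dt fold_dist_Phi//.
  exact: (fold_pdist_mdist treeT treeT' morf t0).
have map_sub' p : subdivision d d' f (s + t) (fold_repr X) (fold_repr Y) p ->
    exists2 P, subdivision dt d' psit s X Y P &
      subdivision_length dt P <= subdivision_length d p.
  by move=> c; apply: (map_sub _ _ _ c); rewrite fold_reprK; apply/Phi_twice_eqP.
apply/eqP; rewrite eq_le; apply/andP; split.
  apply: (fold_pdist_glb treeT treeT' morf st0) => p /map_sub'[P cP].
  apply: le_trans; apply: ge_inf; last by exists P.
  by exists 0 => _ [Q _ <-].
apply: lb_le_inf.
  have [|P cP _] := map_sub' [:: (fold_repr X, fold_repr Y)].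
    by split; exact: fold_equiv_refl.
  by exists (subdivision_length dt P), P.
move=> _ [P cP <-]; elim: P X cP {I map_sub'} => [|[A B] P IH] X' /=.
  by move=> /sims_dist ->.
move=> [/sims_dist XA /IH]; rewrite /subdivision_length big_cons /=.
set l := \big[_/_]_(_ <- P) _ => BY.
have := tree_tri tDs (fold_repr A) (fold_repr X') (fold_repr Y).
have := tree_tri tDs (fold_repr B) (fold_repr A) (fold_repr Y).
have : fold_pdist f (s + t) (fold_repr A) (fold_repr B) <= dt A B.
  exact: le_D.
by lra.
Qed.

End FoldedTree.

(** * Equivariance and the identification of the two trees *)

Lemma fold_equiv_act (R : realType) (G : groupType) (T T' : metricType R)
    (act : G -> T -> T) (act' : G -> T' -> T') (f : T -> T') (t : R) :
  Rtree T -> Rtree T' -> tree_morphism f ->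
  isometric_action act -> isometric_action act' -> equivariant act act' f ->
  forall g a b, fold_equiv mdist mdist f t a b ->
    fold_equiv mdist mdist f t (act g a) (act g b).
Proof.
move=> treeT treeT' morf isoa isoa' eqf g a b.
move=> /(fold_equiv_mdistP treeT treeT' morf)[fab h].
apply/fold_equiv_mdistP => //; split; first by rewrite !eqf fab.
move=> w; have -> : w = act g (act g^-1%g w).
  by rewrite -(act_mul isoa) mulgV (act_one isoa).
rewrite /segment/= !(act_isom isoa) => /h.
by rewrite (eqf g a) (eqf g (act _ w)) (act_isom isoa').
Qed.

(** The two trees are different types of classes, so being the same quotient of [T_0] is expressed
    by [iota]; its last clause determines it, since both [Phi] maps are onto. *)
Theorem proposition3p11 (R : realType) (G : groupType) (T0 Too : metricType R)
    (act0 : G -> T0 -> T0) (actoo : G -> Too -> Too) (f : T0 -> Too) (s t : R)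
    (fgG : finitely_generated G)
    (treeT0 : Rtree T0) (treeToo : Rtree Too)
    (isom0 : isometric_action act0) (isomoo : isometric_action actoo)
    (morf : tree_morphism f) (eqf : equivariant act0 actoo f)
    (s0 : 0 <= s) (t0 : 0 <= t) :
  let d0 : T0 -> T0 -> R := mdist in
  let doo : Too -> Too -> R := mdist in
  let dt := fold_dist d0 doo f t in
  let phit := Phi d0 doo f t in
  let psit := Psi d0 doo f t in
  let actt := fold_act d0 doo f t act0 in
  exists iota : fold_tree dt doo psit s -> fold_tree d0 doo f (s + t),
    [/\ bijective iota,
        forall C D, fold_dist d0 doo f (s + t) (iota C) (iota D) =
                    fold_dist dt doo psit s C D,
        equivariant (fold_act dt doo psit s actt)
                    (fold_act d0 doo f (s + t) act0) iota,
        Psi d0 doo f (s + t) \o iota =1 Psi dt doo psit s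
      & iota \o (Phi dt doo psit s \o phit) =1 Phi d0 doo f (s + t)].
Proof.
move=> d0 doo dt phit psit actt.
have st0 : 0 <= s + t by exact: addr_ge0.
pose iota (C : fold_tree dt doo psit s) : fold_tree d0 doo f (s + t) :=
  Phi d0 doo f (s + t) (fold_repr (fold_repr C)).
(* Choosing representatives twice lands on a point of [T_0] that is equivalent to [a] at parameter
   [s + t]. *)
have iota_Phi a : iota (Phi dt doo psit s (phit a)) = Phi d0 doo f (s + t) a.
  apply/(Phi_mdist_eqP treeT0 treeToo morf _ _ st0).
  apply/(fold_twice_equiv_Phi treeT0 treeToo morf s0 t0); rewrite fold_reprK.
  exact: (fold_repr_Phi_twice treeT0 treeToo morf s0 t0).
exists iota; split.
- exists (fun C => Phi dt doo psit s (phit (fold_repr C))) => C.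
    rewrite -[in RHS](fold_reprK C).
    apply/(Phi_twice_eqP treeT0 treeToo morf s0 t0).
    rewrite -[in X in fold_equiv _ _ _ _ _ X](fold_reprK (fold_repr C)).
    apply/(fold_twice_equiv_Phi treeT0 treeToo morf s0 t0).
    exact: (fold_repr_Phi_mdist treeT0 treeToo morf _ st0).
  by rewrite iota_Phi fold_reprK.
- move=> C D; rewrite (fold_dist_Phi treeT0 treeToo morf _ _ st0).
  by rewrite -(fold_dist_twice treeT0 treeToo morf s0 t0).
- move=> g C; rewrite /fold_act iota_Phi.
  apply/(Phi_mdist_eqP treeT0 treeToo morf _ _ st0).
  apply: (fold_equiv_act treeT0 treeToo morf isom0 isomoo eqf).
  apply: (fold_equiv_sym treeT0 treeToo morf).
  exact: (fold_repr_Phi_mdist treeT0 treeToo morf _ st0).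
- move=> C /=; rewrite /Psi.
  have := fold_repr_Phi_mdist treeT0 treeToo morf (fold_repr (fold_repr C)) st0.
  by case.
- by move=> a; exact: iota_Phi.
Qed.
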